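(* Let $A$ be a $C^{\ast}$-algebra and let $a, b \in A^+ \setminus \{0\}$. Then $ab = 0$ if and only if $$\big\Vert \Vert c\Vert^{-1} c + \Vert d\Vert^{-1} d \big\Vert = 1$$ for all $c, d \in A^+$ with $0 < c \le a$ and $0 < d \le b$.
   Context: $A^+$ is the cone of positive elements of $A$; for self-adjoint $x,y$, $x \le y$ means $y - x \in A^+$, and $0 < c$ means $c \in A^+$ and $c \neq 0$. The algebra $A$ need not be unital. *)

(* Defs.v *)
From HB Require Import structures.
From mathcomp Require Import all_boot all_order all_algebra.
From mathcomp Require Import complex.
From mathcomp Require Import all_classical all_reals all_analysis.
Set Implicit Arguments.
Unset Strict Implicit.
Unset Printing Implicit Defensive.
Import Order.TTheory GRing.Theory Num.Theory.
Local Open Scope classical_set_scope.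
Local Open Scope ring_scope.
Local Open Scope complex_scope.

(* A C*-algebra, not assumed unital: a complex Banach space with an associative
   bilinear submultiplicative product and a conjugate-linear involution.  The
   norm takes its values in the nonnegative reals of R[i]. *)
HB.mixin Record CompleteNormedModule_isCStarAlgebra (R : realType) (A : Type)
    of CompleteNormedModule R[i] A := {
  cmul : A -> A -> A;
  cstar : A -> A;
  cmulA : forall x y z : A, cmul x (cmul y z) = cmul (cmul x y) z;
  cmulDl : forall x y z : A, cmul (x + y) z = cmul x z + cmul y z;
  cmulDr : forall x y z : A, cmul x (y + z) = cmul x y + cmul x z;
  cscalerAl : forall (l : R[i]) (x y : A), cmul (l *: x) y = l *: cmul x y;
  cscalerAr : forall (l : R[i]) (x y : A), cmul x (l *: y) = l *: cmul x y;
  cstarK : forall x : A, cstar (cstar x) = x;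
  cstarD : forall x y : A, cstar (x + y) = cstar x + cstar y;
  cstarZ : forall (l : R[i]) (x : A), cstar (l *: x) = Num.conj l *: cstar x;
  cstarM : forall x y : A, cstar (cmul x y) = cmul (cstar y) (cstar x);
  cnormM : forall x y : A, `|cmul x y| <= `|x| * `|y| :> R[i];
  cnorm_star_mul : forall x : A, `|cmul (cstar x) x| = `|x| ^+ 2 :> R[i];
}.

#[short(type="cstarAlgType")]
HB.structure Definition CStarAlgebra (R : realType) :=
  { A of CompleteNormedModule R[i] A
       & CompleteNormedModule_isCStarAlgebra R A }.

Definition self_adjoint (R : realType) (A : cstarAlgType R) (x : A) : Prop :=
  cstar x = x.

(* The unitization A (+) C of A; the pair (x, l) stands for x + l 1. *)
Definition unitz_mul (R : realType) (A : cstarAlgType R) (u v : A * R[i]) :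
    A * R[i] :=
  (cmul u.1 v.1 + u.2 *: v.1 + v.2 *: u.1, u.2 * v.2).

Definition unitz_one (R : realType) (A : cstarAlgType R) : A * R[i] := (0, 1).

Definition unitz_invertible (R : realType) (A : cstarAlgType R)
    (u : A * R[i]) : Prop :=
  exists v : A * R[i],
    unitz_mul u v = unitz_one A /\ unitz_mul v u = unitz_one A.

(* The spectrum is taken in the unitization even when A has a unit: this can
   only add the point 0, hence does not affect positivity. *)
Definition spectrum (R : realType) (A : cstarAlgType R) (x : A) : set R[i] :=
  [set l | ~ unitz_invertible (x, - l)].

(* In R[i], 0 <= l means that l is real and nonnegative. *)
Definition positive (R : realType) (A : cstarAlgType R) : set A :=
  [set x | self_adjoint x /\ spectrum x `<=` [set l | 0 <= l]].
Arguments positive {R} A.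

Definition cle (R : realType) (A : cstarAlgType R) (x y : A) : Prop :=
  [/\ self_adjoint x, self_adjoint y & positive A (y - x)].

(* Main.v *)
Require Import Defs.
From HB Require Import structures.
From mathcomp Require Import all_boot all_order all_algebra.
From mathcomp Require Import complex.
From mathcomp Require Import all_classical all_reals all_analysis.
From mathcomp Require Import ring lra.
Set Implicit Arguments.
Unset Strict Implicit.
Unset Printing Implicit Defensive.
Import Order.TTheory GRing.Theory Num.Theory.
Import numFieldNormedType.Exports.
Local Open Scope classical_set_scope.
Local Open Scope ring_scope.
Local Open Scope complex_scope.

(* If [a b = 0] and [0 <= c <= a], conjugating by [h = b + e] gives
   [h c h <= h a h = e ^ 2 a], so [c b = 0] as [e] tends to 0, and likewise
   [c d = 0]; for orthogonal self-adjoint [c], [d] of norm 1 one has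
   [(c + d) ^ n = c ^ n + d ^ n], and the C*-identity gives norm 1.
   Conversely, take [d = b] and [c = e a (a + e) ^ -1 <= a].  Norm 1 means
   [c / |c| + b / |b| <= 1], where [c / |c| >= a (a + e) ^ -1], so
   [b / |b| <= e (a + e) ^ -1]; conjugating by [sqrt (a + e)] and letting [e] tend
   to 0 yields [b a = 0].
   All of this takes place in the unitization with its C*-norm.  Complex analysis
   (Gelfand theory, the spectral radius formula) is avoided: order is handled
   through [|t - u| <= t], square roots of [1 - y] with [|y| < 1] come from a
   contraction, and the link with the spectrum is that a self-adjoint [p] with
   [|p| <= 1] and [1 - p ^ 2] invertible has [|p| < 1]. *)

(** * Identities in noncommutative rings *)

(* The tactic [ring] requires commutativity: [ncring] expands the products and
   compares the coefficients of the resulting words. *)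
Inductive zexpr := ZZero | ZAtom of nat | ZAdd of zexpr & zexpr | ZOpp of zexpr.

Fixpoint zeval (V : zmodType) (l : seq V) e : V :=
  match e with
  | ZZero => 0
  | ZAtom i => l`_i
  | ZAdd e1 e2 => zeval l e1 + zeval l e2
  | ZOpp e1 => - zeval l e1
  end.

Fixpoint zcoef e (i : nat) : int :=
  match e with
  | ZZero => 0
  | ZAtom j => (i == j)%:R
  | ZAdd e1 e2 => zcoef e1 i + zcoef e2 i
  | ZOpp e1 => - zcoef e1 i
  end.

Lemma zevalE (V : zmodType) (l : seq V) e :
  zeval l e = \sum_(i < size l) l`_i *~ zcoef e i.
Proof.
elim: e => [|j|e1 IH1 e2 IH2|e1 IH1] /=.
- by rewrite big1.
- have [jl|lj] := ltnP j (size l).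
    rewrite (bigD1 (Ordinal jl)) //= eqxx big1 ?addr0 // => i ij.
    by rewrite (_ : (i == j :> nat) = false) //; apply: negbTE.
  rewrite nth_default // big1 // => i _.
  by rewrite (_ : (i == j :> nat) = false) //; apply/ltn_eqF/(leq_trans _ lj).
- by rewrite IH1 IH2 -big_split; apply: eq_bigr => i _; rewrite mulrzDr.
- by rewrite IH1 -sumrN; apply: eq_bigr => i _; rewrite mulrNz.
Qed.

(** Soundness of the reflection: on closed expressions the premise is settled by computation. *)
Lemma zeval_eq (V : zmodType) (l : seq V) e1 e2 :
  all (fun i => zcoef e1 i == zcoef e2 i) (iota 0 (size l)) ->
  zeval l e1 = zeval l e2.
Proof.
move=> /allP H; rewrite !zevalE; apply: eq_bigr => i _; congr (_ *~ _).
by apply/eqP/H; rewrite mem_iota ltn_ord.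
Qed.

Ltac zindex x l :=
  match l with
  | ?y :: _ => let _ := match goal with _ => unify x y end in constr:(0%N)
  | _ :: ?l' => let n := zindex x l' in constr:(n.+1)
  end.
Ltac zmember x l :=
  match l with
  | _ => let _ := zindex x l in l
  | _ => constr:(x :: l)
  end.
Ltac zatoms e l :=
  lazymatch e with
  | GRing.zero => l
  | GRing.add ?a ?b => let l1 := zatoms a l in zatoms b l1
  | GRing.opp ?a => zatoms a l
  | _ => zmember e l
  end.
Ltac zreify e l :=
  lazymatch e with
  | GRing.zero => constr:(ZZero)
  | GRing.add ?a ?b =>
      let a' := zreify a l in let b' := zreify b l in constr:(ZAdd a' b')
  | GRing.opp ?a => let a' := zreify a l in constr:(ZOpp a')
  | _ => let n := zindex e l in constr:(ZAtom n)
  end.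
Ltac zmodule :=
  lazymatch goal with
  | |- @eq ?V ?a ?b =>
    let l := zatoms a (@nil V) in let l := zatoms b l in
    let a' := zreify a l in let b' := zreify b l in
    change (zeval l a' = zeval l b'); exact: zeval_eq
  end.
Ltac ncring :=
  rewrite ?(mulrDl, mulrDr, mulNr, mulrN, opprD, opprK);
  rewrite ?(mul1r, mulr1, mul0r, mulr0, mulrA); zmodule.

(** * Unital C*-algebras *)

Definition rnorm (R : realType) (V : normedZmodType R[i]) (x : V) : R :=
  complex.Re `|x|.

Lemma rnormE (R : realType) (V : normedZmodType R[i]) (x : V) :
  `|x| = (rnorm x)%:C.
Proof. by rewrite /rnorm RRe_real // normr_real. Qed.

Lemma rnorm_real (R : realType) (t : R) : rnorm (t%:C : R[i]) = `|t|.
Proof. by rewrite /rnorm normc_def /= expr0n addr0 sqrtr_sqr. Qed.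

(* The real-valued norm and the geometric form of completeness spare the
   construction of the topology of the unitization. *)
HB.mixin Record Algebra_isUnitalCStar (R : realType) (B : Type)
    of GRing.Algebra R[i] B := {
  star : B -> B;
  cnorm : B -> R;
  starK : forall x, star (star x) = x;
  starD : forall x y, star (x + y) = star x + star y;
  starZ : forall (l : R[i]) x, star (l *: x) = Num.conj l *: star x;
  starM : forall x y, star (x * y) = star y * star x;
  cnormD : forall x y, cnorm (x + y) <= cnorm x + cnorm y;
  cnormZ_le : forall (l : R[i]) x, cnorm (l *: x) <= rnorm l * cnorm x;
  cnorm1 : cnorm 1 = 1;
  cnorm_eq0 : forall x, cnorm x = 0 -> x = 0;
  ucnormM : forall x y, cnorm (x * y) <= cnorm x * cnorm y;
  cnorm_sq : forall x, cnorm x ^+ 2 <= cnorm (star x * x);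
  cnorm_complete : forall (z : nat -> B) (C rho : R), 0 <= rho -> rho < 1 ->
    (forall n, cnorm (z n.+1 - z n) <= C * rho ^+ n) ->
    exists l, forall e, 0 < e ->
      exists n0, forall n, (n0 <= n)%N -> cnorm (z n - l) <= e }.

#[short(type="ucstarType")]
HB.structure Definition UnitalCStar (R : realType) :=
  { B of GRing.Algebra R[i] B & Algebra_isUnitalCStar R B }.

Lemma ler_lin_eps (R : realFieldType) (r s t : R) :
  (forall e, 0 < e -> e <= 1 -> r <= s + t * e) -> r <= s.
Proof.
move=> H; apply/ler_addgt0Pr => e e0.
have D0 : 0 < e + `|t| by rewrite ltr_pwDl.
(* This scale lies in [(0, 1]], and its product with [t] is at most [e], even when [t = 0]. *)
apply: le_trans (H (e / (e + `|t|)) _ _) _.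
- by rewrite divr_gt0.
- by rewrite ler_pdivrMr // mul1r lerDl.
rewrite lerD2l mulrA ler_pdivrMr // mulrC ler_pM2l //.
by have := ler_norm t; lra.
Qed.

Section UnitalCStar.
Context {R : realType} {B : ucstarType R}.
Implicit Types (x y z u v p q h : B) (s t e : R).
Local Notation N := (@cnorm R B).
Local Notation star := (@star R B).
Local Notation comm := GRing.comm.

Definition scal t : B := t%:C%:A.
Definition sa u := star u = u.
Definition is_inv u v := u * v = 1 /\ v * u = 1.

Lemma scal0 : scal 0 = 0. Proof. by rewrite /scal scale0r. Qed.
Lemma scal1 : scal 1 = 1. Proof. by rewrite /scal scale1r. Qed.
Lemma scalD s t : scal (s + t) = scal s + scal t.
Proof. by rewrite /scal rmorphD scalerDl. Qed.
Lemma scalN t : scal (- t) = - scal t.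
Proof. by rewrite /scal rmorphN scaleNr. Qed.
Lemma scalB s t : scal (s - t) = scal s - scal t.
Proof. by rewrite scalD scalN. Qed.
Lemma scalM s t : scal (s * t) = scal s * scal t.
Proof. by rewrite /scal rmorphM -scalerAl mul1r scalerA. Qed.
Lemma scal_comm t u : comm (scal t) u.
Proof. by rewrite /comm /scal -scalerAl -scalerAr mul1r mulr1. Qed.
Lemma comm_scal u t : comm u (scal t).
Proof. exact/commr_sym/scal_comm. Qed.

Lemma star1 : star 1 = 1.
Proof. by have := starM (star 1) 1; rewrite mulr1 !starK mulr1. Qed.
Lemma star0 : star 0 = 0.
Proof. by apply: (addrI (star 0)); rewrite -starD !addr0. Qed.
Lemma starN u : star (- u) = - star u.
Proof. by apply/eqP; rewrite -addr_eq0 -starD addNr star0. Qed.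
Lemma starB u v : star (u - v) = star u - star v.
Proof. by rewrite starD starN. Qed.

Lemma conj_real t : Num.conj (t%:C : R[i]) = t%:C.
Proof. by rewrite conj_Creal // realE !lecE /= eqxx le_total. Qed.

Lemma sa_scal t : sa (scal t).
Proof. by rewrite /sa /scal starZ star1 conj_real. Qed.
Lemma sa1 : sa 1. Proof. exact: star1. Qed.
Lemma sa0 : sa 0. Proof. exact: star0. Qed.
Lemma saD u v : sa u -> sa v -> sa (u + v).
Proof. by rewrite /sa starD => -> ->. Qed.
Lemma saB u v : sa u -> sa v -> sa (u - v).
Proof. by rewrite /sa starB => -> ->. Qed.
Lemma saM u v : sa u -> sa v -> comm u v -> sa (u * v).
Proof. by rewrite /sa starM => -> -> ->. Qed.
Lemma sa_sqr u : sa u -> sa (u * u).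
Proof. by move=> su; apply: saM. Qed.
Lemma sa_conj h u : sa h -> sa u -> sa (h * u * h).
Proof. by rewrite /sa !starM => -> ->; rewrite mulrA. Qed.

Lemma rnormN1 : rnorm (-1 : R[i]) = 1.
Proof. by rewrite /rnorm normrN1. Qed.

Lemma cnorm0 : N 0 = 0.
Proof.
apply/eqP; rewrite eq_le; apply/andP; split.
  by have := cnormZ_le 0 (0 : B); rewrite scale0r /rnorm normr0 mul0r.
have := cnormD (0 : B) 0; rewrite addr0; lra.
Qed.
Lemma cnormN u : N (- u) = N u.
Proof.
have H x : N (- x) <= N x.
  by have := cnormZ_le (-1) x; rewrite scaleN1r rnormN1 mul1r.
by apply/eqP; rewrite eq_le H -{1}(opprK u) H.
Qed.
Lemma cnorm_distC u v : N (u - v) = N (v - u).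
Proof. by rewrite -cnormN opprB. Qed.
Lemma cnorm_ge0 u : 0 <= N u.
Proof. have := cnormD u (- u); rewrite subrr cnorm0 cnormN; lra. Qed.
Lemma cnormB u v : N (u - v) <= N u + N v.
Proof. by rewrite -(cnormN v) cnormD. Qed.
(** [cnormZ_le] gives one inequality only; the other is the same bound at [t^-1] combined with
    submultiplicativity in [1 = scal t * scal t^-1]. *)
Lemma cnorm_scal t : N (scal t) = `|t|.
Proof.
have H s : N (scal s) <= `|s|.
  by have := cnormZ_le s%:C (1 : B); rewrite rnorm_real cnorm1 mulr1.
apply/eqP; rewrite eq_le H /=; have [->|t0] := eqVneq t 0.
  by rewrite normr0 cnorm_ge0.
have := ucnormM (scal t) (scal t^-1); rewrite -scalM divff // scal1 cnorm1 => H1.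
have := H t^-1; rewrite normfV => H2.
have t0' : 0 < `|t| by rewrite normr_gt0.
have : 1 <= N (scal t) * `|t|^-1.
  by apply: le_trans H1 _; rewrite ler_wpM2l ?cnorm_ge0.
by rewrite ler_pdivlMr // mul1r.
Qed.
Lemma cnorm_scalM t u : N (scal t * u) = `|t| * N u.
Proof.
have H s x : N (scal s * x) <= `|s| * N x by rewrite -(cnorm_scal s) ucnormM.
apply/eqP; rewrite eq_le H /=; have [->|t0] := eqVneq t 0.
  by rewrite normr0 mul0r cnorm_ge0.
have := H t^-1 (scal t * u); rewrite mulrA -scalM mulVf // scal1 mul1r normfV.
by rewrite mulrC ler_pdivlMr ?normr_gt0 // mulrC.
Qed.

Lemma cnorm_star u : N (star u) = N u.
Proof.
have H x : N x <= N (star x).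
  have := le_trans (cnorm_sq x) (ucnormM _ _).
  have := cnorm_ge0 x; rewrite le_eqVlt => /orP[/eqP<- _|x0].
    exact: cnorm_ge0.
  by rewrite expr2 ler_pM2r.
by apply/eqP; rewrite eq_le (H u) -{2}(starK u) H.
Qed.

Lemma cnorm_starM u : N (star u * u) = N u ^+ 2.
Proof.
apply/eqP; rewrite eq_le cnorm_sq andbT.
by apply: le_trans (ucnormM _ _) _; rewrite cnorm_star expr2.
Qed.

Lemma cnorm_sa_sqr u : sa u -> N (u * u) = N u ^+ 2.
Proof. by move=> su; rewrite -cnorm_starM su. Qed.

Lemma eq0_cnorm_le_eps u (C : R) :
  (forall e, 0 < e -> e <= 1 -> N u <= C * e) -> u = 0.
Proof.
move=> H; apply: cnorm_eq0; apply/eqP; rewrite eq_le cnorm_ge0 andbT.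
by apply: (@ler_lin_eps _ _ _ C) => e e0 e1; rewrite add0r H.
Qed.

(** A form of Banach's fixed point theorem. As [P] is not supposed closed and [F] contracts only on
    [P], the limit [l] comes with nearby points of [P] almost fixed by [F]; identities then pass to
    [l] with an explicit error. *)
Lemma contraction_approx (F : B -> B) (P : B -> Prop) (rho : R) :
  0 <= rho -> rho < 1 -> P 0 -> (forall u, P u -> P (F u)) ->
  (forall u v, P u -> P v -> N (F u - F v) <= rho * N (u - v)) ->
  exists l, forall e, 0 < e ->
    exists u, [/\ P u, N (u - l) <= e & N (F u - u) <= e].
Proof.
move=> r0 r1 P0 PF cF; pose z n := iter n F 0.
have Pz n : P (z n) by elim: n => //= n; apply: PF.
have [|l hl] := @cnorm_complete _ _ z (N (F 0)) rho r0 r1.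
  elim=> [|n IH] /=; first by rewrite subr0 expr0 mulr1.
  apply: le_trans (cF _ _ (Pz n.+1) (Pz n)) _.
  by rewrite exprS mulrCA ler_wpM2l.
exists l => e e0; have e20 : 0 < e / 2 by rewrite divr_gt0.
have [n hn] := hl _ e20; exists (z n).
have h1 := hn n (leqnn n); have h2 := hn n.+1 (leqnSn n).
split => //; first by lra.
rewrite -[F _](subrK l) -addrA (cnorm_distC _ l) in h1 *.
by apply: le_trans (cnormD _ _) _; rewrite [F _]/(z n.+1); lra.
Qed.

(** The inverse is the fixed point of [v -> 1 + u v]. The iterates commute with [u], which makes the
    limit a two-sided inverse. *)
Lemma neumann u : N u < 1 -> exists v, is_inv (1 - u) v.
Proof.
move=> u1; pose F v := 1 + u * v.
pose P v := comm u v.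
have [| | |v hv] := @contraction_approx F P (N u) (cnorm_ge0 u) u1.
- exact: commr0.
- by move=> v Pv; apply: commrD; [exact: commr1|exact: commrM].
- by move=> v w _ _; rewrite /F opprD addrACA subrr add0r -mulrBr ucnormM.
exists v; split; apply/esym/eqP; rewrite -subr_eq0; apply/eqP;
  apply: (@eq0_cnorm_le_eps _ (2 + N u)) => e e0 _; have [w [Pw h1 h2]] := hv e e0.
  have -> : 1 - (1 - u) * v = (F w - w) + (w - v) - u * (w - v).
    by rewrite /F; ncring.
  apply: le_trans (cnormB _ _) _; apply: le_trans (lerD (cnormD _ _) (ucnormM _ _)) _.
  have : N u * N (w - v) <= N u * e by rewrite ler_wpM2l ?cnorm_ge0.
  by lra.
have -> : 1 - v * (1 - u) = (F w - w) + (w - v) - (w - v) * u.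
  by rewrite /F Pw; ncring.
apply: le_trans (cnormB _ _) _; apply: le_trans (lerD (cnormD _ _) (ucnormM _ _)) _.
have : N (w - v) * N u <= e * N u by rewrite ler_wpM2r ?cnorm_ge0.
by lra.
Qed.

(** The root is [1 - z], where [z] is the fixed point of [z -> (y + z ^ 2) / 2]. *)
Lemma sqrt_one_sub y : sa y -> N y < 1 ->
  exists p, [/\ sa p, p * p = 1 - y & forall m, comm m y -> comm m p].
Proof.
(* [r] is the smaller root of [r ^ 2 - 2 r + N y = 0]: the ball of radius [r] is mapped into itself,
   and [r] is also the contraction factor there. *)
move=> sy y1; pose r := 1 - Num.sqrt (1 - N y).
have r2 : (1 - r) * (1 - r) = 1 - N y.
  rewrite /r opprB addrCA subrr addr0 -expr2 sqr_sqrtr; lra.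
have r1 : r < 1 by rewrite /r ltrBlDr ltrDl sqrtr_gt0; lra.
have r0 : 0 <= r.
  by have := cnorm_ge0 y; nra.
pose F z := scal 2^-1 * (y + z * z).
(* Commuting with all that commutes with [y] makes any two points of [P] commute, so that
   [u ^ 2 - v ^ 2] factors in the contraction estimate. *)
pose P z := [/\ sa z, N z <= r & forall m, comm m y -> comm m z].
have Pyz z : P z -> comm y z by case=> _ _ H; apply: H.
have PP u v : P u -> P v -> comm u v.
  by move=> Pu [_ _ Hv]; apply: Hv; apply/commr_sym/Pyz.
have [| | |z hz] := @contraction_approx F P r r0 r1.
- by split; [exact: sa0|rewrite cnorm0|move=> m _; apply: commr0].
- move=> u [su Nu cu]; split.
  + by apply: saM (sa_scal _) (saD sy (sa_sqr su)) (scal_comm _ _).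
  + rewrite cnorm_scalM ger0_norm ?invr_ge0 //.
    have := cnormD y (u * u); have := ucnormM u u; have := cnorm_ge0 u; nra.
  + move=> m my; apply: commrM; first exact: comm_scal.
    by apply: commrD => //; apply: commrM; apply: cu.
- move=> u v Pu Pv; have cuv := PP _ _ Pu Pv.
  have -> : F u - F v = scal 2^-1 * ((u + v) * (u - v)).
    rewrite /F -mulrBr opprD addrACA subrr add0r; congr (_ * _).
    by rewrite mulrDl !mulrBr cuv addrA subrK.
  rewrite cnorm_scalM ger0_norm ?invr_ge0 //.
  have := ucnormM (u + v) (u - v); have := cnormD u v.
  case: Pu Pv => _ Nu _ [_ Nv _]; have := cnorm_ge0 (u - v); nra.
exists (1 - z); split.
- apply: saB sa1 _; apply/eqP; rewrite -subr_eq0; apply/eqP.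
  apply: (@eq0_cnorm_le_eps _ 2) => e e0 _; have [w [[sw _ _] h1 _]] := hz e e0.
  have -> : star z - z = (w - z) - star (w - z) by rewrite starB sw; ncring.
  apply: le_trans (cnormB _ _) _; rewrite cnorm_star; lra.
- apply/eqP; rewrite -subr_eq0; apply/eqP.
  apply: (@eq0_cnorm_le_eps _ (4 + N (1 - z))) => e e0 _.
  have [w [[_ Nw _] h1 h2]] := hz e e0.
  have h3 : scal 2 * (F w - w) = (1 - w) * (1 - w) - (1 - y).
    rewrite mulrBr mulrA -scalM divff ?pnatr_eq0 // scal1 mul1r.
    have -> : scal 2 = 1 + 1 by rewrite -!scal1 -scalD.
    by ncring.
  have -> : (1 - z) * (1 - z) - (1 - y) =
      ((1 - z) * (w - z) + (w - z) * (1 - w)) + scal 2 * (F w - w).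
    by rewrite h3; ncring.
  apply: le_trans (cnormD _ _) _.
  apply: le_trans (lerD (cnormD _ _) (lexx _)) _.
  rewrite cnorm_scalM ger0_norm //.
  have := ucnormM (1 - z) (w - z); have := ucnormM (w - z) (1 - w).
  have := cnormB 1 w; rewrite cnorm1.
  have := cnorm_ge0 (w - z); have := cnorm_ge0 (1 - z).
  have := cnorm_ge0 (1 - w); nra.
- move=> m my; apply: commrB; first exact: commr1.
  apply/eqP; rewrite -subr_eq0; apply/eqP.
  apply: (@eq0_cnorm_le_eps _ (2 * N m)) => e e0 _; have [w [[_ _ cw] h1 _]] := hz e e0.
  have -> : m * z - z * m = (w - z) * m - m * (w - z).
    by rewrite mulrBl mulrBr (cw _ my); ncring.
  apply: le_trans (cnormB _ _) _.
  have := ucnormM (w - z) m; have := ucnormM m (w - z); have := cnorm_ge0 m; nra.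
Qed.
End UnitalCStar.

(** * Square roots and inverses *)

Section SquareRoots.
Context {R : realType} {B : ucstarType R}.
Implicit Types (x y z u v p q h : B) (s t e : R).
Local Notation N := (@cnorm R B).
Local Notation star := (@star R B).
Local Notation comm := GRing.comm.
Lemma sqrt_sub r y : sa y -> N y < r ->
  exists p, [/\ sa p, p * p = scal r - y & forall m, comm m y -> comm m p].
Proof.
move=> sy yr; have r0 : 0 < r by apply: le_lt_trans (cnorm_ge0 _) yr.
have [||p [sp pp cp]] := @sqrt_one_sub R B (scal r^-1 * y).
- exact: saM (sa_scal _) sy (scal_comm _ _).
- by rewrite cnorm_scalM gtr0_norm ?invr_gt0 // mulrC ltr_pdivrMr // mul1r.
exists (scal (Num.sqrt r) * p); split.
- exact: saM (sa_scal _) sp (scal_comm _ _).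
- rewrite -mulrA (mulrA p) -(scal_comm _ p) -mulrA pp mulrA -scalM -expr2.
  rewrite sqr_sqrtr ?ltW // mulrBr mulr1 mulrA -scalM divff ?gt_eqF //.
  by rewrite scal1 mul1r.
- move=> m my; apply: commrM; first exact: comm_scal.
  by apply: cp; apply: commrM => //; apply: comm_scal.
Qed.

Lemma neumann_sub r y : N y < r -> exists v, is_inv (scal r - y) v.
Proof.
move=> yr; have r0 : 0 < r by apply: le_lt_trans (cnorm_ge0 _) yr.
have [|v [v1 v2]] := @neumann R B (scal r^-1 * y).
  by rewrite cnorm_scalM gtr0_norm ?invr_gt0 // mulrC ltr_pdivrMr // mul1r.
have rr : scal r * scal r^-1 = 1 :> B by rewrite -scalM divff ?gt_eqF // scal1.
have -> : scal r - y = scal r * (1 - scal r^-1 * y).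
  by rewrite mulrBr mulr1 mulrA rr mul1r.
exists (scal r^-1 * v); split.
  by rewrite -mulrA (mulrA _ _ v) -(scal_comm _ (1 - _)) -(mulrA (scal r^-1)) v1 mulr1.
by rewrite -mulrA (mulrA v) -(scal_comm _ v) -(mulrA (scal r)) v2 mulr1
   -(scal_comm _ (scal r^-1)) rr.
Qed.

Lemma inv_comm m u v : is_inv u v -> comm m u -> comm m v.
Proof.
move=> [uv vu] mu; rewrite /comm -[LHS]mul1r -vu -mulrA (mulrA u) -mu.
by rewrite -mulrA uv mulr1.
Qed.

Lemma inv_sa u v : is_inv u v -> sa u -> sa v.
Proof.
move=> [uv vu] su; rewrite /sa -[LHS]mulr1 -uv mulrA -{1}su -starM uv star1.
by rewrite mul1r.
Qed.

Lemma inv_of_comm_mul u v : comm u v -> (exists w, is_inv (u * v) w) ->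
  exists w, is_inv u w.
Proof.
move=> uv [w uvw]; have [w1 w2] := uvw; exists (v * w); split.
  by rewrite mulrA.
have cw : comm v w.
  by apply: (inv_comm uvw); apply: commrM => //; apply/commr_sym.
by rewrite cw -mulrA -uv w2.
Qed.

(** For [z = u + i v], commutation gives [star z * z = u ^ 2 + v ^ 2], and [u] is the real part of
    [z], so [N u <= N z]. This monotonicity of the norm precedes any theory of positivity. *)
Lemma cnorm_sqr_le_add u v : sa u -> sa v -> comm u v ->
  N (u * u) <= N (u * u + v * v).
Proof.
move=> su sv uv; pose z := u + 'i *: v.
have sz : star z = u - 'i *: v.
  by rewrite /z starD starZ su sv conjCi scaleNr.
have -> : u * u + v * v = star z * z.
  have iu : u * ('i *: v) = 'i *: v * u by rewrite -scalerAr -scalerAl uv.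
  have iv : 'i *: v * ('i *: v) = - (v * v).
    by rewrite -scalerAr -scalerAl scalerA -expr2 sqrCi scaleN1r.
  by rewrite sz /z mulrDl !mulrDr mulNr iu mulNr iv; ncring.
rewrite cnorm_starM cnorm_sa_sqr // ler_pXn2r ?nnegrE ?cnorm_ge0 //.
have -> : u = scal 2^-1 * (star z + z).
  have -> : star z + z = scal 2 * u.
    have -> : scal 2 = 1 + 1 :> B by rewrite -!scal1 -scalD.
    by rewrite sz /z; ncring.
  by rewrite mulrA -scalM mulVf ?pnatr_eq0 // scal1 mul1r.
rewrite cnorm_scalM ger0_norm ?invr_ge0 //.
have := cnormD (star z) z; rewrite cnorm_star; lra.
Qed.

Lemma sqr_sub_comm x y : comm x y -> x * x - y * y = (x - y) * (x + y).
Proof. by move=> xy; rewrite mulrBl !mulrDr xy; ncring. Qed.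

(* With [q = p * p] and [v] the inverse of [1 - q], one finds [q + e * e = 1 - d]
   for [e] self-adjoint commuting with [p] and some [d > 0]: formally
   [e = sqrt (1 - q - d)], obtained as the quotient of
   [sqrt ((1 - q) ^ 2 - d ^ 2)] by [sqrt (1 - q + d)]. *)
Lemma cnorm_lt1_of_inv p : sa p -> N p <= 1 -> (exists v, is_inv (1 - p * p) v) ->
  N p < 1.
Proof.
move=> sp p1 [v qv]; have [qv1 vq1] := qv.
set q := p * p in qv qv1 vq1 *; set Q := 1 - q in qv qv1 vq1 *.
have sq : sa q by exact: sa_sqr.
have sQ : sa Q by apply: saB sa1 sq.
have Nq : N q = N p ^+ 2 by rewrite /q cnorm_sa_sqr.
have sv : sa v by apply: inv_sa qv sQ.
(* Small enough that [d * N v < 1], which provides [s] with [s ^ 2 = 1 - (d v) ^ 2]. *)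
pose d := (1 + N v)^-1.
have Nv0 := cnorm_ge0 v.
have d0 : 0 < d by rewrite invr_gt0; lra.
have d1 : d <= 1 by rewrite invf_le1; lra.
have dv : d * N v < 1 by rewrite mulrC ltr_pdivrMr; lra.
have cpQ : comm p Q by apply: commrB; [exact: commr1|exact: commrM].
have cpv : comm p v by apply: inv_comm qv cpQ.
have cQv : comm Q v by rewrite /comm qv1 vq1.
have cdv m : comm m v -> comm m (scal d * v * (scal d * v)).
  move=> mv; have h : comm m (scal d * v) by apply: commrM => //; apply: comm_scal.
  exact: commrM.
have sdv : sa (scal d * v) by apply: saM (sa_scal _) sv (scal_comm _ _).
have [||s [ss s2 cs]] := @sqrt_one_sub R B (scal d * v * (scal d * v)).
- exact: sa_sqr.
- rewrite cnorm_sa_sqr // cnorm_scalM gtr0_norm // expr_lt1 // mulr_ge0 // ltW //.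
have [|k [sk k2 ck]] := @sqrt_sub (1 + d) q sq.
- rewrite Nq; have := cnorm_ge0 p; nra.
have [|w hw] := @neumann_sub (1 + d) q.
- rewrite Nq; have := cnorm_ge0 p; nra.
rewrite -k2 in hw; have [w1 w2] := hw.
have ekk : k * k = Q + scal d by rewrite k2 scalD scal1 /Q; ncring.
have cq m : comm m Q -> comm m q.
  move=> mQ; have -> : q = 1 - Q by rewrite /Q; ncring.
  by apply: commrB => //; exact: commr1.
have cck m : comm m Q -> comm m k by move=> mQ; apply: ck; apply: cq.
have ccs m : comm m Q -> comm m s.
  by move=> mQ; apply: cs; apply: cdv; apply: inv_comm qv mQ.
have ccw m : comm m Q -> comm m w.
  by move=> mQ; apply: inv_comm hw _; apply: commrM; apply: cck.
have sw : sa w by apply: inv_sa hw _; apply: sa_sqr.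
have ckw : comm k w by apply: ccw; apply/commr_sym/cck.
have csw : comm s w by apply: ccw; apply/commr_sym/ccs.
have csk : comm s k by apply: cck; apply/commr_sym/ccs.
(* Since [Q v = 1], [(Q s) ^ 2 = Q ^ 2 - d ^ 2]; and [k w] is the inverse of [k], where
   [k ^ 2 = Q + d]. Hence [e ^ 2 = Q - d]. *)
pose e := Q * (s * (k * w)).
have cQskw : comm Q (s * (k * w)).
  by apply: commrM; [exact: ccs|apply: commrM; [exact: cck|exact: ccw]].
have cskw : comm s (k * w) by apply: commrM.
have se : sa e by apply: saM => //; apply: saM => //; apply: saM.
have pe : comm p e.
  apply: commrM => //; apply: commrM; first exact: ccs.
  by apply: commrM; [exact: cck|exact: ccw].
have e2 : e * e = Q - scal d.
  have -> : e * e = Q * Q * (s * s) * (k * k * w * w).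
    by rewrite -[LHS]expr2 /e !exprMn_comm // !expr2 !mulrA.
  have -> : Q * Q * (s * s) = Q * Q - scal d * scal d.
    rewrite s2 mulrBr mulr1; congr (_ - _).
    have -> : scal d * v * (scal d * v) = v * (v * (scal d * scal d)).
      by rewrite (scal_comm d v) -mulrA (mulrA (scal d)) (scal_comm d v) !mulrA.
    by rewrite -mulrA (mulrA Q v) qv1 mul1r (mulrA Q) qv1 mul1r.
  have -> : Q * Q - scal d * scal d = (Q - scal d) * (Q + scal d).
    exact/sqr_sub_comm/comm_scal.
  by rewrite w1 mul1r -ekk -mulrA w1 mulr1.
have : N q <= N (q + e * e) by apply: cnorm_sqr_le_add.
have -> : q + e * e = scal (1 - d).
  by rewrite e2 scalB scal1 /Q; ncring.
rewrite cnorm_scal ger0_norm ?subr_ge0 // Nq.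
have := cnorm_ge0 p; nra.
Qed.

End SquareRoots.

(** * The positive cone *)

Section Order.
Context {R : realType} {B : ucstarType R}.
Implicit Types (x y z u v p q h : B) (s t e : R).
Local Notation N := (@cnorm R B).
Local Notation star := (@star R B).
Local Notation comm := GRing.comm.
(** Positivity without the spectrum: in this form, stability under sums is the triangle inequality.
    [psd_of_inv] and [inv_sub_of_psd] relate it to invertibility. *)
Definition psd u := sa u /\ exists t, N (scal t - u) <= t.

Lemma psdD u v : psd u -> psd v -> psd (u + v).
Proof.
move=> [su [s us]] [sv [t vt]]; split; first exact: saD.
exists (s + t); rewrite scalD opprD addrACA.
by apply: le_trans (cnormD _ _) _; apply: lerD.
Qed.

Lemma psd_scal t : 0 <= t -> psd (scal t : B).
Proof.
by move=> t0; split; [exact: sa_scal|exists t; rewrite subrr cnorm0].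
Qed.

Lemma psdZ t u : 0 <= t -> psd u -> psd (scal t * u).
Proof.
move=> t0 [su [s us]]; split; first exact: saM (sa_scal _) su (scal_comm _ _).
by exists (t * s); rewrite scalM -mulrBr cnorm_scalM ger0_norm // ler_wpM2l.
Qed.

Lemma psd_scal_sub t u : sa u -> N u <= t -> psd (scal t - u).
Proof.
move=> su ut; split; first exact: saB (sa_scal _) su.
by exists t; rewrite opprB addrC subrK.
Qed.

(** [u + e = (t + e) - (t - u)] with [N (t - u) <= t < t + e], so [sqrt_sub] applies. The shift [e]
    supplies the strict inequality and is removed later by letting it tend to 0. *)
Lemma psd_sqrt u e : psd u -> 0 < e ->
  exists p, [/\ sa p, p * p = u + scal e & forall m, comm m u -> comm m p].
Proof.
move=> [su [t ut]] e0.
have [||p [sp pp cp]] := @sqrt_sub R B (t + e) (scal t - u).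
- exact: saB (sa_scal _) su.
- lra.
exists p; split => //; first by rewrite pp scalD; ncring.
by move=> m mu; apply: cp; apply: commrB => //; exact: comm_scal.
Qed.

Lemma psd_inv u e : psd u -> 0 < e -> exists v, is_inv (u + scal e) v.
Proof.
move=> [su [t ut]] e0.
have [|v hv] := @neumann_sub R B (t + e) (scal t - u); first by lra.
exists v; suff -> : u + scal e = scal (t + e) - (scal t - u) by [].
by rewrite scalD; ncring.
Qed.

(** The witness is [t = N (p * p)]: if [s ^ 2 = t + e / 2 - p ^ 2], then [cnorm_sqr_le_add] bounds
    [N (s ^ 2)] by the norm of the scalar [t + e / 2]. *)
Lemma psd_sqr p : sa p -> psd (p * p).
Proof.
move=> sp; have spp := sa_sqr sp; split => //; exists (N (p * p)).
apply/ler_addgt0Pr => e e0.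
have e20 : 0 < e / 2 by rewrite divr_gt0.
have [|s [ss s2 cs]] := @sqrt_sub R B (N (p * p) + e / 2) (p * p) spp; first by lra.
have cps : comm s p by apply/commr_sym/cs; exact: commrM.
have := cnorm_sqr_le_add ss sp cps; rewrite s2 subrK cnorm_scal ger0_norm.
  move=> H.
  have -> : scal (N (p * p)) - p * p = scal (N (p * p) + e / 2) - p * p - scal (e / 2).
    by rewrite scalD; ncring.
  apply: le_trans (cnormB _ _) _; rewrite cnorm_scal gtr0_norm //; lra.
by have := cnorm_ge0 (p * p); lra.
Qed.

(** Up to a shift, [u] and [t - u] are squares of commuting elements whose sum is a scalar, so
    [cnorm_sqr_le_add] applies. *)
Lemma cnorm_le_psd t u : psd u -> psd (scal t - u) -> N u <= t.
Proof.
move=> pu pt; apply/ler_addgt0Pr => e e0.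
have e0' : 0 < e / 4 by rewrite divr_gt0.
have [p [sp pp cp]] := psd_sqrt pu e0'.
have [s [ss s2 cs]] := psd_sqrt pt e0'.
have cps : comm p s.
  apply: cs; apply: commrB; first exact: comm_scal.
  by apply/commr_sym/cp.
have := cnorm_sqr_le_add sp ss cps; rewrite pp s2.
have -> : u + scal (e / 4) + (scal t - u + scal (e / 4)) = scal (t + e / 2).
  have -> : t + e / 2 = t + e / 4 + e / 4 by lra.
  by rewrite !scalD; ncring.
rewrite cnorm_scal => H.
(* [scal t] is a sum of two [psd] elements, and a bound [|r - t| <= r] excludes [t < 0]. *)
have t0 : 0 <= t + e / 2.
  have [st [r hr]] := psdD pu pt.
  have [] := leP 0 (t + e / 2) => // tn.
  move: hr; have -> : u + (scal t - u) = scal t by ncring.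
  rewrite -scalB cnorm_scal; have := ler_norm (r - t); lra.
move: H; rewrite ger0_norm // => H.
rewrite -[u](addrK (scal (e / 4))); apply: le_trans (cnormB _ _) _.
rewrite cnorm_scal gtr0_norm //; lra.
Qed.

Lemma cnorm_le_of_psd_sub u v : psd u -> psd (v - u) -> N u <= N v.
Proof.
move=> pu pvu; apply: cnorm_le_psd => //.
have pv : psd v by rewrite -(subrK u v); apply: psdD.
have -> : scal (N v) - u = (scal (N v) - v) + (v - u) by ncring.
by apply: psdD => //; apply: psd_scal_sub => //; case: pv.
Qed.

Lemma invC u v : is_inv u v -> is_inv v u.
Proof. by case. Qed.

Lemma invM u u' v v' : is_inv u u' -> is_inv v v' -> is_inv (u * v) (v' * u').
Proof.
move=> [u1 u2] [v1 v2]; split.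
  by rewrite mulrA -(mulrA u) v1 mulr1.
by rewrite mulrA -(mulrA v') u2 mulr1.
Qed.

Lemma inv_scal r : r != 0 -> is_inv (scal r : B) (scal r^-1).
Proof. by move=> r0; rewrite /is_inv -!scalM divff // mulVf // scal1. Qed.

(** Take [t = N u + 1] and [y = t - u]. If [r = N y > t], then [r - y = u + (r - t)] is invertible
    by hypothesis and [r + y = (r + t) - u] by a Neumann series. So [1 - (y / r) ^ 2] is invertible,
    and [cnorm_lt1_of_inv] contradicts [N (y / r) = 1]. *)
Lemma psd_of_inv u : sa u -> (forall t, 0 < t -> exists v, is_inv (u + scal t) v) ->
  psd u.
Proof.
move=> su hu; split => //; exists (N u + 1); set t := N u + 1.
have Nu := cnorm_ge0 u.
rewrite leNgt; apply/negP; set y := scal t - u; set r := N y => tr.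
have r0 : 0 < r by rewrite /t in tr; lra.
have sy : sa y by apply: saB (sa_scal _) su.
have rr : scal r * scal r^-1 = 1 :> B by rewrite -scalM divff ?gt_eqF // scal1.
have rr' : scal r^-1 * scal r = 1 :> B by rewrite scal_comm.
suff : N (scal r^-1 * y) < 1.
  by rewrite cnorm_scalM gtr0_norm ?invr_gt0 // mulVf ?ltxx // gt_eqF.
apply: cnorm_lt1_of_inv.
- exact: saM (sa_scal _) sy (scal_comm _ _).
- by rewrite cnorm_scalM gtr0_norm ?invr_gt0 // mulVf // gt_eqF.
have [v1 hv1] : exists v, is_inv (scal r - y) v.
  have -> : scal r - y = u + scal (r - t) by rewrite /y scalB; ncring.
  by apply: hu; rewrite subr_gt0.
have [v2 hv2] : exists v, is_inv (scal r + y) v.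
  have -> : scal r + y = scal (r + t) - u by rewrite /y scalD; ncring.
  by apply: neumann_sub; rewrite /t; lra.
clearbody y.
have E : 1 - scal r^-1 * y * (scal r^-1 * y) =
    scal r^-1 * scal r^-1 * ((scal r - y) * (scal r + y)).
  rewrite -sqr_sub_comm ?mulrBr; last exact: scal_comm.
  have -> : scal r^-1 * scal r^-1 * (scal r * scal r) = 1 :> B.
    by rewrite -mulrA (mulrA _ (scal r)) rr' mul1r rr'.
  by rewrite -!mulrA (mulrA y) -(scal_comm _ y) !mulrA.
have ir : is_inv (scal r^-1 : B) (scal r) by apply/invC/inv_scal; rewrite gt_eqF.
by rewrite E; eexists; apply: invM (invM ir ir) (invM hv1 hv2).
Qed.

(* [h u h + t = h (u + t h^-2) h], and [h^-2] is bounded below. *)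
Lemma psd_conj h u : sa h -> (exists k, is_inv h k) -> psd u -> psd (h * u * h).
Proof.
move=> sh [k hk] pu; have [k1 k2] := hk; have sk := inv_sa hk sh.
apply: psd_of_inv; first by apply: sa_conj => //; case: pu.
(* [d] is the lower bound for [k ^ 2 = h ^ -2]: as [N (d h ^ 2) < 1], there is [r] with
   [r ^ 2 = 1 - d h ^ 2], and [k ^ 2 - d = (k r) ^ 2]. *)
move=> t t0; pose d := (1 + N h ^+ 2)^-1.
have Nh := cnorm_ge0 h; have d0 : 0 < d by rewrite invr_gt0; nra.
have chk : comm h k by rewrite /comm k1 k2.
have [||r [sr r2 cr]] := @sqrt_one_sub R B (scal d * (h * h)).
- exact: saM (sa_scal _) (sa_sqr sh) (scal_comm _ _).
- by rewrite cnorm_scalM cnorm_sa_sqr // gtr0_norm // mulrC ltr_pdivrMr; nra.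
have ckr : comm k r.
  apply: cr; apply: commrM; first exact: comm_scal.
  by apply: commrM; apply/commr_sym.
have pk : psd (k * k - scal d).
  have -> : k * k - scal d = (k * r) * (k * r).
    rewrite -[RHS]expr2 exprMn_comm // !expr2 r2 mulrBr mulr1.
    congr (_ - _); rewrite -(comm_scal _ d) -!mulrA (mulrA k h) k2 mul1r.
    by rewrite mulrA k2 mul1r.
  by apply: psd_sqr; apply: saM.
have E : h * u * h + scal t =
    h * (u + scal t * (k * k - scal d) + scal (t * d)) * h.
  have -> : u + scal t * (k * k - scal d) + scal (t * d) = u + k * scal t * k.
    by rewrite scalM -(scal_comm t k); ncring.
  by rewrite mulrDr mulrDl !mulrA k1 mul1r -(mulrA (scal t)) k2 mulr1.
have [|v hv] := @psd_inv (u + scal t * (k * k - scal d)) (t * d) _ (mulr_gt0 t0 d0).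
  by apply: psdD => //; apply: psdZ => //; exact: ltW.
by rewrite E; eexists; apply: invM (invM hk hv) hk.
Qed.

(** If [u = p ^ 2], then [N (p p h) ^ 2 <= N p ^ 2 * N (p h) ^ 2], and the C*-identity evaluates
    both factors. Only [u + e] is known to have a root, hence the error terms linear in [e]. *)
Lemma cnorm_mul_sqr_le u h : psd u -> sa h -> N (u * h) ^+ 2 <= N u * N (h * u * h).
Proof.
move=> pu sh; have Nu := cnorm_ge0 u; have Nhh := cnorm_ge0 (h * h).
have Nhuh := cnorm_ge0 (h * u * h).
have step e : 0 < e ->
    N ((u + scal e) * h) ^+ 2 <= (N u + e) * (N (h * u * h) + e * N (h * h)).
  move=> e0; have [p [sp pp _]] := psd_sqrt pu e0.
  have Np : N p ^+ 2 <= N u + e.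
    rewrite -cnorm_sa_sqr // pp; apply: le_trans (cnormD _ _) _.
    by rewrite cnorm_scal gtr0_norm.
  have Nph : N (p * h) ^+ 2 <= N (h * u * h) + e * N (h * h).
    rewrite -cnorm_starM starM sp sh mulrA -(mulrA h p) pp.
    have -> : h * (u + scal e) * h = h * u * h + scal e * (h * h).
      by rewrite mulrDr -(scal_comm e h); ncring.
    by apply: le_trans (cnormD _ _) _; rewrite cnorm_scalM gtr0_norm.
  rewrite -pp -mulrA.
  have := ucnormM p (p * h); have := cnorm_ge0 p; have := cnorm_ge0 (p * h).
  have := cnorm_ge0 (p * (p * h)).
  move=> a0 b0 c0 abc.
  have : N (p * (p * h)) ^+ 2 <= (N p * N (p * h)) ^+ 2.
    by rewrite ler_pXn2r ?nnegrE ?mulr_ge0.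
  rewrite exprMn => /le_trans; apply.
  by apply: ler_pM; rewrite ?exprn_ge0.
have Nh := cnorm_ge0 h; have Nuh := cnorm_ge0 (u * h).
apply: (@ler_lin_eps _ _ _ (N (h * u * h) + N u * N (h * h) + N (h * h)
   + 2 * N (u * h) * N h)) => e e0 e1.
have := step e e0.
have : N (u * h) <= N ((u + scal e) * h) + e * N h.
  rewrite -[X in X <= _](congr1 N (addrK (scal e * h) (u * h))) -mulrDl.
  by apply: le_trans (cnormB _ _) _; rewrite cnorm_scalM gtr0_norm.
have := cnorm_ge0 ((u + scal e) * h).
set y := N ((u + scal e) * h); set x := N (u * h) in Nuh *; set n := N h in Nh *.
set a := N u in Nu *; set b := N (h * u * h) in Nhuh *.
set c := N (h * h) in Nhh *; move=> y0 h2 h1.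
have h3 : (a + e) * (b + e * c) <= a * b + e * (b + a * c + c).
  have : 0 <= e * c * (1 - e) by rewrite !mulr_ge0 ?subr_ge0 // ltW.
  lra.
(* The inequality [x - e n <= y] can be squared when [e n <= x]; otherwise [x ^ 2 <= x e n]
   already. *)
have h4 : x ^+ 2 <= y ^+ 2 + 2 * (x * n * e).
  have xne : 0 <= x * n * e by rewrite !mulr_ge0 // ltW.
  have y2 := sqr_ge0 y.
  have [h5|h5] := leP (e * n) x.
    have : (x - e * n) ^+ 2 <= y ^+ 2.
      by rewrite ler_pXn2r ?nnegrE ?subr_ge0 // lerBlDr.
    have := sqr_ge0 (e * n); lra.
  have : x * x <= x * (e * n) by rewrite ler_wpM2l // ltW.
  lra.
lra.
Qed.

(** A negative real [l] is a positive shift of [u]. For [l = x + i y] with [y != 0], put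
    [w = u - x]: the product of [w - i y] and [w + i y] is [w ^ 2 + y ^ 2], a positive shift of a
    square. *)
Lemma inv_sub_of_psd u (l : R[i]) : psd u -> ~~ (0 <= l) ->
  exists v, is_inv (u - l%:A) v.
Proof.
move=> pu; case: l => x y l0; have [su _] := pu.
have El : (x +i* y)%:A = scal x + 'i *: scal y :> B.
  by rewrite /scal scalerA -scalerDl [in LHS](complexE (x +i* y)) complexiE.
have [y0|y0] := eqVneq y 0.
  have x0 : x < 0 by move: l0; rewrite y0 lecE /= eqxx ltNge.
  rewrite El y0 scal0 scaler0 addr0 -scalN; apply: psd_inv => //; lra.
pose w := u - scal x.
have sw : sa w by apply: saB su (sa_scal _).
have y2 : 0 < y * y by rewrite -expr2 exprn_even_gt0.
have [v hv] := psd_inv (psd_sqr sw) y2.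
have -> : u - (x +i* y)%:A = w - 'i *: scal y by rewrite El /w; ncring.
clearbody w.
have cw : comm w ('i *: scal y) by rewrite /comm -scalerAr -scalerAl comm_scal.
apply: (@inv_of_comm_mul _ _ _ (w + 'i *: scal y)).
  have cw' := commr_sym cw.
  by apply: commrD; apply/commr_sym; apply: commrB.
exists v; rewrite -sqr_sub_comm // -scalerAr -scalerAl scalerA -(expr2 'i) sqrCi.
by rewrite scaleN1r opprK -scalM.
Qed.
End Order.

(** * Orthogonal positive elements *)

Section Orthogonality.
Context {R : realType} {B : ucstarType R}.
Implicit Types (a b c d x y z u v p q h k : B) (s t e : R).
Local Notation N := (@cnorm R B).
Local Notation star := (@star R B).
Local Notation comm := GRing.comm.

Lemma sa_mul0 a b : sa a -> sa b -> a * b = 0 -> b * a = 0.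
Proof. by move=> sa_a sb ab; rewrite -sb -{1}sa_a -starM ab star0. Qed.

Lemma orthogonal_of_le a b c : psd b -> psd c -> psd (a - c) -> a * b = 0 ->
  c * b = 0.
Proof.
move=> pb pc pac ab; have [sb _] := pb.
have sa_a : sa a by rewrite -(subrK c a); apply: saD; [case: pac|case: pc].
have ba := sa_mul0 sa_a sb ab.
have Na := cnorm_ge0 a; have Nc := cnorm_ge0 c.
apply: (@eq0_cnorm_le_eps _ _ _ (2 * N c + N a)) => e e0 _.
pose h := b + scal e; have [k hk] := psd_inv pb e0.
have sh : sa h by apply: saD sb (sa_scal _).
have hah : h * a * h = scal (e * e) * a.
  by rewrite /h mulrDl ba add0r -mulrA mulrDr ab add0r (comm_scal a) mulrA scalM.
have h1 : N (h * c * h) <= e * e * N a.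
  have -> : e * e * N a = N (h * a * h).
    by rewrite hah cnorm_scalM ger0_norm ?mulr_ge0 ?ltW.
  apply: cnorm_le_of_psd_sub; first by apply: psd_conj => //; exists k.
  by rewrite -mulrBl -mulrBr; apply: psd_conj => //; exists k.
(* Bounding [N c * N a] by [(N c + N a) ^ 2] spares a square root. *)
have h2 : N (c * h) <= e * (N c + N a).
  rewrite -(@ler_pXn2r _ 2) ?nnegrE ?cnorm_ge0 ?mulr_ge0 ?addr_ge0 ?(ltW e0) //.
  apply: le_trans (cnorm_mul_sqr_le pc sh) _.
  apply: le_trans (ler_wpM2l Nc h1) _.
  rewrite exprMn -expr2 mulrCA ler_pM2l ?exprn_gt0 //; nra.
have -> : c * b = c * h - scal e * c by rewrite mulrDr (comm_scal c) addrK.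
apply: le_trans (cnormB _ _) _; rewrite cnorm_scalM gtr0_norm //; lra.
Qed.

(* [(c + d) ^ n = c ^ n + d ^ n], so [N (c + d) ^ n <= 2] for [n] a power of 2. *)
Lemma cnorm_add_orthogonal c d : sa c -> sa d -> c * d = 0 -> N c = 1 -> N d = 1 ->
  N (c + d) = 1.
Proof.
move=> sc_c sd cd Nc Nd; have dc := sa_mul0 sc_c sd cd.
set x := c + d.
have N_exp2 n : N (x ^+ (2 ^ n)) = N x ^+ (2 ^ n).
  elim: n => // n IH; rewrite expnSr !exprM -IH expr2 -cnorm_sa_sqr //.
  have : sa x by apply: saD.
  elim: (2 ^ n)%N => [_|m IHm sx]; first by rewrite expr0; exact: sa1.
  rewrite exprS; apply: saM sx (IHm sx) _; exact: commrX.
(* The exponents start at 1: at 0 the right-hand side would be 2. *)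
have x_exp n : x ^+ n.+1 = c ^+ n.+1 + d ^+ n.+1.
  elim: n => // n IH; rewrite exprS IH mulrDl !mulrDr -!exprS.
  have -> : c * d ^+ n.+1 = 0 by rewrite exprS mulrA cd mul0r.
  have -> : d * c ^+ n.+1 = 0 by rewrite exprS mulrA dc mul0r.
  by rewrite addr0 add0r.
have N_exp1 y n : N y = 1 -> N (y ^+ n) <= 1.
  move=> Ny; elim: n => [|n IH]; first by rewrite expr0 cnorm1.
  by rewrite exprS; apply: le_trans (ucnormM _ _) _; rewrite Ny mul1r.
apply/eqP; rewrite eq_le; apply/andP; split; last first.
  have : N (c * x) = 1 by rewrite mulrDr cd addr0 cnorm_sa_sqr // Nc expr1n.
  by have := ucnormM c x; rewrite Nc mul1r => + <-.
rewrite leNgt; apply/negP => x1.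
have le2 n : N x ^+ (2 ^ n) <= 2.
  rewrite -N_exp2 -(prednK (expn_gt0 2 n : (0 < 2 ^ n)%N)) x_exp.
  apply: le_trans (cnormD _ _) _; have := N_exp1 c (2 ^ n).-1.+1 Nc.
  have := N_exp1 d (2 ^ n).-1.+1 Nd; lra.
have bern n : 1 + n%:R * (N x - 1) <= N x ^+ n.
  elim: n => [|n IH]; first by rewrite expr0 mul0r addr0.
  rewrite exprS -natr1; have n0 := ler0n R n.
  have : 0 <= n%:R * (N x - 1) ^+ 2 by rewrite mulr_ge0 ?sqr_ge0.
  have : N x * (1 + n%:R * (N x - 1)) <= N x * N x ^+ n by rewrite ler_wpM2l ?cnorm_ge0.
  lra.
(* With this [n], [(n + 1) (N x - 1) > 1], so Bernoulli's inequality at the exponent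
   [2 ^ (n + 1) > n + 1] pushes the power beyond 2. *)
pose n := Num.truncn (N x - 1)^-1.
have hn : (N x - 1)^-1 < n.+1%:R by apply: truncnS_gt.
have : 1 < n.+1%:R * (N x - 1) by rewrite -ltr_pdivrMr ?subr_gt0 // div1r.
have h3 := bern (2 ^ n.+1)%N; have h4 := le2 n.+1.
have : n.+1%:R * (N x - 1) <= (2 ^ n.+1)%:R * (N x - 1).
  by rewrite ler_wpM2r ?subr_ge0 ?ltW // ltr_nat ltn_expl.
lra.
Qed.

(* The test elements are [c = e a (a + e) ^ -1 <= a]; as [e] tends to 0, [c / N c]
   becomes a unit for [a], which forces [b a] to vanish. *)
Lemma mul0_of_norm_add a b : psd a -> a <> 0 -> psd b -> b <> 0 ->
  (forall c z, c = z * a * z -> psd c -> c <> 0 -> psd (a - c) ->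
    N (scal (N c)^-1 * c + scal (N b)^-1 * b) = 1) ->
  a * b = 0.
Proof.
move=> pa a0 pb b0 H; have [sa_a _] := pa; have [sb _] := pb.
have Nb0 : N b != 0 by apply/eqP => /cnorm_eq0.
have Nb : 0 < N b by rewrite lt0r Nb0 cnorm_ge0.
apply: (sa_mul0 sb sa_a).
pose b' := scal (N b)^-1 * b.
have pb' : psd b' by apply: psdZ => //; rewrite invr_ge0 ltW.
have Nb' : N b' = 1 by rewrite cnorm_scalM gtr0_norm ?invr_gt0 // mulVf.
suff b'a : b' * a = 0.
  have -> : b = scal (N b) * b' by rewrite mulrA -scalM divff // scal1 mul1r.
  by rewrite -mulrA b'a mulr0.
(* The shift of [a] is [f = e ^ 2], because [f] will bound the square of [N (b' * q)]. *)
apply: (@eq0_cnorm_le_eps _ _ _ (N a + 2)) => e e0 e1; pose f := e ^+ 2.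
have f0 : 0 < f by rewrite exprn_gt0.
have f1 : f <= 1 by rewrite expr_le1 // ltW.
have [q [sq qq cq]] := psd_sqrt pa f0.
have qu : exists k, is_inv q k.
  by apply: (@inv_of_comm_mul R B q q) => //; rewrite qq; apply: psd_inv.
have [k hk] := qu; have [qk kq] := hk; have sk : sa k by apply: inv_sa hk sq.
have ak : comm a k by apply: inv_comm hk _; apply: cq.
(* With [k = (a + f) ^ (-1/2)], this is [a (a + f) ^ -1] in a visibly self-adjoint form, and
   [1 - c1 = f (a + f) ^ -1]. *)
pose c1 := k * a * k.
have pc1 : psd c1 by apply: psd_conj => //; exists q; apply: invC.
have c1E : 1 - c1 = scal f * (k * k).
  have -> : 1 = k * (q * q) * k :> B by rewrite mulrA kq mul1r qk.
  by rewrite qq mulrDr mulrDl addrAC subrr add0r (comm_scal k) mulrA.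
have p1c1 : psd (1 - c1) by rewrite c1E; apply: psdZ (ltW f0) (psd_sqr sk).
have c1_neq0 : c1 <> 0.
  move=> c10; apply: a0; have -> : a = q * c1 * q.
    by rewrite /c1 !mulrA qk mul1r -mulrA kq mulr1.
  by rewrite c10 mulr0 mul0r.
have Nc1 : 0 < N c1 by rewrite lt0r cnorm_ge0 andbT; apply/eqP => /cnorm_eq0.
have Nc1_le : N c1 <= 1 by apply: cnorm_le_psd; rewrite ?scal1.
have pc : psd (scal f * c1) by apply: psdZ pc1; exact: ltW.
(* [f c1 = a (1 - c1)], so the difference is [a c1 = (a k) ^ 2]. *)
have pac : psd (a - scal f * c1).
  have -> : a - scal f * c1 = (a * k) * (a * k).
    have -> : scal f * c1 = a * (1 - c1).
      by rewrite c1E /c1 -ak !mulrA (comm_scal a).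
    by rewrite mulrBr mulr1 subKr /c1 !mulrA.
  by apply: psd_sqr; apply: saM.
(* The form [z a z] shows that, in a unitization, the test element lies in the same ideal as [a]. *)
have cz : scal f * c1 = (scal e * k) * a * (scal e * k).
  rewrite /f expr2 scalM /c1 -!mulrA; congr (_ * _).
  by rewrite !mulrA (scal_comm e k) -!mulrA (mulrA (scal e)) (scal_comm e a) !mulrA.
have cn0 : scal f * c1 <> 0.
  by move=> /(congr1 N); rewrite cnorm_scalM gtr0_norm // cnorm0; nra.
have := H _ _ cz pc cn0 pac; rewrite -/b'; set c' := scal _ * (_ * _) => Nc'b'.
have c'E : c' = scal (N c1)^-1 * c1.
  rewrite /c' cnorm_scalM gtr0_norm // mulrA -scalM invfM mulrAC mulVf ?mul1r //.
  by rewrite gt_eqF.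
have pc' : psd c' by rewrite c'E; apply: psdZ => //; rewrite invr_ge0 ltW.
have p1 : psd (1 - (c' + b')).
  rewrite -scal1; apply: psd_scal_sub; last by rewrite Nc'b'.
  by apply: saD; [case: pc'|case: pb'].
have p2 : psd (c' - c1).
  have -> : c' - c1 = scal ((N c1)^-1 - 1) * c1 by rewrite c'E scalB scal1; ncring.
  by apply: psdZ => //; rewrite subr_ge0 invf_ge1.
have p3 : psd (q * (scal f * (k * k) - b') * q).
  apply: psd_conj => //.
  rewrite -c1E; have -> : 1 - c1 - b' = (1 - (c' + b')) + (c' - c1) by ncring.
  exact: psdD.
have p4 : q * (scal f * (k * k) - b') * q = scal f - q * b' * q.
  rewrite mulrBr mulrBl; congr (_ - _).
  by rewrite (mulrA q) (comm_scal q) -!mulrA kq mulr1 qk mulr1.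
have h1 : N (q * b' * q) <= f.
  by apply: cnorm_le_psd; [exact: psd_conj|rewrite -p4].
have h2 : N (b' * q) <= e.
  rewrite -(@ler_pXn2r _ 2) ?nnegrE ?cnorm_ge0 ?(ltW e0) //.
  by apply: le_trans (cnorm_mul_sqr_le pb' sq) _; rewrite Nb' mul1r.
have Nq2 : N q ^+ 2 <= N a + 1.
  rewrite -cnorm_sa_sqr // qq; apply: le_trans (cnormD _ _) _.
  by rewrite cnorm_scal gtr0_norm // lerD2l.
have -> : b' * a = b' * q * q - scal f * b'.
  by rewrite -mulrA qq mulrDr (comm_scal b') addrK.
apply: le_trans (cnormB _ _) _; rewrite cnorm_scalM gtr0_norm // Nb' mulr1.
have h3 := ucnormM (b' * q) q.
have h4 : N (b' * q) * N q <= e * N q by rewrite ler_wpM2r ?cnorm_ge0.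
have h5 : f <= e by rewrite /f expr2; nra.
(* This square yields [2 N q <= N q ^ 2 + 1 <= N a + 2], whence the constant [N a + 2]. *)
have h6 := sqr_ge0 (N q - 1); have h7 := cnorm_ge0 a.
have h8 : e * N q <= e * ((N a + 2) / 2) by rewrite ler_pM2l //; lra.
have h9 : 0 <= e * N a by rewrite mulr_ge0 // ltW.
lra.
Qed.
End Orthogonality.

(** * Norms, limits and C*-algebras *)

Lemma geometric_cauchy (R : realType) (V : zmodType) (nu : V -> R)
    (z : nat -> V) (C rho : R) :
  nu 0 = 0 -> (forall x y, nu (x + y) <= nu x + nu y) ->
  0 <= C -> 0 <= rho -> rho < 1 ->
  (forall n, nu (z n.+1 - z n) <= C * rho ^+ n) ->
  forall e, 0 < e -> exists n0, forall n k, (n0 <= n)%N ->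
    nu (z (n + k)%N - z n) <= e.
Proof.
move=> nu0 nuD C0 r0 r1 hz e e0; pose r' := 1 - rho.
have r'0 : 0 < r' by rewrite subr_gt0.
have H n k : nu (z (n + k)%N - z n) * r' <= C * rho ^+ n * (1 - rho ^+ k).
  elim: k => [|k IH]; first by rewrite addn0 subrr nu0 expr0 subrr mul0r mulr0.
  have -> : z (n + k.+1)%N - z n = (z (n + k).+1 - z (n + k)%N) + (z (n + k)%N - z n).
    by rewrite addnS subrKA.
  have h1 := hz (n + k)%N.
  have h2 := nuD (z (n + k).+1 - z (n + k)%N) (z (n + k)%N - z n).
  move: h1; rewrite exprD mulrA => h1.
  have h3 := ler_wpM2r (ltW r'0) (le_trans h2 (lerD h1 (lexx _))).
  apply: (le_trans h3); rewrite mulrDl -/r' exprS.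
  move: IH; rewrite /r'; set a := C * _; set b := rho ^+ k; lra.
(* The denominator is [C + 1] since [C] may be 0. *)
have e'0 : 0 < e * r' / (C + 1) by rewrite divr_gt0 ?mulr_gt0 // ltr_wpDl.
have rc : (rho ^+ n) @[n --> \oo] --> 0 by apply: cvg_expr; rewrite ger0_norm.
have [n0 _ hn0] := cvgr_dist_le _ _ rc _ e'0; exists n0 => n k /hn0 /=.
rewrite sub0r normrN ger0_norm ?exprn_ge0 // ler_pdivlMr ?ltr_wpDl // => h.
rewrite -(ler_pM2r r'0); apply: le_trans (H n k) _.
have rn := exprn_ge0 n r0; have rk := exprn_ge0 k r0.
have : 0 <= C * rho ^+ n * rho ^+ k by rewrite !mulr_ge0.
lra.
Qed.

(** The general field [K] covers both [A], with tolerances in [R[i]], and the real and imaginary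
    parts of scalars, with tolerances in [R]. *)
Lemma cauchy_seq_limit (K : numFieldType) (V : completeNormedModType K)
    (z : nat -> V) :
  (forall e : K, 0 < e -> exists n0, forall n, (n0 <= n)%N -> `|z n - z n0| <= e) ->
  exists l, forall e : K, 0 < e -> exists n0, forall n, (n0 <= n)%N ->
    `|z n - l| <= e.
Proof.
move=> hz.
have /cvg_ex[l hl] : cvg (z @ \oo).
  apply/cauchy_cvgP/cauchy_exP => e e0.
  have [|n0 hn0] := hz (e / 2); first by rewrite divr_gt0.
  exists (z n0); exists n0 => // n /= /hn0 h; rewrite -ball_normE /= distrC.
  by apply: le_lt_trans h _; rewrite ltr_pdivrMr // ltr_pMr // ltr1n.
exists l => e e0.
have [n0 _ hn0] := cvgr_dist_le _ _ hl _ e0.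
by exists n0 => n nn0; rewrite distrC; apply: hn0.
Qed.

Section RealNorm.
Context {R : realType} {V : normedModType R[i]}.
Implicit Types (x y : V) (l : R[i]).

Lemma rnorm_ge0 (W : normedZmodType R[i]) (x : W) : 0 <= rnorm x.
Proof. by rewrite -lecR -rnormE normr_ge0. Qed.
Lemma rnormD (W : normedZmodType R[i]) (x y : W) :
  rnorm (x + y) <= rnorm x + rnorm y.
Proof. by rewrite -lecR rmorphD /= -!rnormE ler_normD. Qed.
Lemma rnorm0 (W : normedZmodType R[i]) : rnorm (0 : W) = 0.
Proof. by rewrite /rnorm normr0. Qed.
Lemma rnorm_eq0 (W : normedZmodType R[i]) (x : W) : rnorm x = 0 -> x = 0.
Proof. by move=> x0; apply/eqP; rewrite -normr_eq0 rnormE x0. Qed.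
Lemma rnormZ l x : rnorm (l *: x) = rnorm l * rnorm x.
Proof. by apply: complexI; rewrite rmorphM /= -!rnormE normrZ. Qed.
Lemma rnormM (l k : R[i]) : rnorm (l * k) = rnorm l * rnorm k.
Proof. by apply: complexI; rewrite rmorphM /= -!rnormE normrM. Qed.
Lemma rnorm_conj l : rnorm (Num.conj l) = rnorm l.
Proof. by rewrite /rnorm norm_conjC. Qed.
Lemma norm_Re_le l : `|complex.Re l| <= rnorm l.
Proof. by rewrite -lecR -rnormE normc_ge_Re. Qed.
Lemma norm_Im_le l : `|complex.Im l| <= rnorm l.
Proof.
rewrite /rnorm normc_def /= -sqrtr_sqr ler_wsqrtr //.
by rewrite lerDr sqr_ge0.
Qed.
Lemma rnorm_le l : rnorm l <= `|complex.Re l| + `|complex.Im l|.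
Proof.
rewrite {1}(complexE l); apply: le_trans (rnormD _ _) _.
rewrite rnormM !rnorm_real lerD2l /rnorm normc_def /= expr0n add0r expr1n.
by rewrite sqrtr1 mul1r.
Qed.
End RealNorm.

(** * The norm of the unitization *)

Section CStar.
Context {R : realType} {A : cstarAlgType R}.
Implicit Types (x y : A) (l : R[i]) (u v : A * R[i]).

Lemma rnorm_cmul x y : rnorm (cmul x y) <= rnorm x * rnorm y.
Proof. by rewrite -lecR rmorphM /= -!rnormE cnormM. Qed.

Lemma rnorm_star_mul x : rnorm (cmul (cstar x) x) = rnorm x ^+ 2.
Proof. by apply: complexI; rewrite rmorphXn /= -!rnormE cnorm_star_mul. Qed.

Lemma rnorm_cstar x : rnorm (cstar x) = rnorm x.
Proof.
have H y : rnorm y <= rnorm (cstar y).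
  have := rnorm_cmul (cstar y) y; rewrite rnorm_star_mul.
  have := rnorm_ge0 y; rewrite le_eqVlt => /orP[/eqP<- _|y0].
    exact: rnorm_ge0.
  by rewrite expr2 ler_pM2r.
by apply/eqP; rewrite eq_le (H x) -{2}(cstarK x) H.
Qed.

Lemma cmul0x x : cmul 0 x = 0.
Proof. by rewrite -[0 in LHS](scale0r (0 : A)) cscalerAl scale0r. Qed.
Lemma cmulx0 x : cmul x 0 = 0.
Proof. by rewrite -[0 in LHS](scale0r (0 : A)) cscalerAr scale0r. Qed.

Definition act u y : A := cmul u.1 y + u.2 *: y.
Definition unitz_star u : A * R[i] := (cstar u.1, Num.conj u.2).

Lemma unitz_mulA : associative (@unitz_mul R A).
Proof.
move=> [x k] [y l] [z m]; rewrite /unitz_mul /= mulrA; congr pair.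
rewrite !cmulDl !cmulDr !scalerDr !scalerA !cmulA !cscalerAl !cscalerAr.
by rewrite (mulrC l m) (mulrC k m); zmodule.
Qed.

Lemma unitz_mul1l : left_id (unitz_one A) (@unitz_mul R A).
Proof.
by move=> [x k]; rewrite /unitz_mul /= cmul0x scaler0 scale1r mul1r add0r addr0.
Qed.

Lemma unitz_mul1r : right_id (unitz_one A) (@unitz_mul R A).
Proof.
by move=> [x k]; rewrite /unitz_mul /= cmulx0 scaler0 scale1r mulr1 !add0r.
Qed.

Lemma unitz_mulDl : left_distributive (@unitz_mul R A) +%R.
Proof.
move=> [x k] [y l] [z m]; rewrite /unitz_mul /= mulrDl; congr pair.
by rewrite cmulDl scalerDl scalerDr /=; zmodule.
Qed.

Lemma unitz_mulDr : right_distributive (@unitz_mul R A) +%R.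
Proof.
move=> [x k] [y l] [z m]; rewrite /unitz_mul /= mulrDr; congr pair.
by rewrite cmulDr scalerDl scalerDr /=; zmodule.
Qed.

Lemma unitz_1neq0 : unitz_one A != 0.
Proof. by apply/eqP => -[] /eqP; rewrite oner_eq0. Qed.

Lemma act_mul u v y : act (unitz_mul u v) y = act u (act v y).
Proof.
rewrite /act /= !cmulDl !cmulDr !scalerDr !cscalerAl !cscalerAr cmulA scalerA.
by zmodule.
Qed.

Lemma actD u v y : act (u + v) y = act u y + act v y.
Proof. by rewrite /act /= cmulDl scalerDl; zmodule. Qed.

Lemma star_act u x y : cmul (cstar (act u x)) y = cmul (cstar x) (act (unitz_star u) y).
Proof.
by rewrite /act cstarD cstarM cstarZ cmulDl cmulDr cscalerAl cscalerAr cmulA.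
Qed.

Definition ubound u (r : R) :=
  [/\ 0 <= r, rnorm u.2 <= r & forall y, rnorm (act u y) <= r * rnorm y].

(* The component [rnorm u.2] keeps this a norm when [A] already has a unit [e],
   in which case [(- e, 1)] acts as zero. *)
Definition unorm u : R := inf [set r | ubound u r].

Lemma ubound_ex u : ubound u (rnorm u.1 + rnorm u.2).
Proof.
have h1 := rnorm_ge0 u.1; have h2 := rnorm_ge0 u.2; split; try lra.
move=> y; apply: le_trans (rnormD _ _) _.
by rewrite rnormZ mulrDl lerD // rnorm_cmul.
Qed.

Lemma unorm_le u r : ubound u r -> unorm u <= r.
Proof. by move=> ur; apply: ge_inf => //; exists 0 => s []. Qed.

Lemma unormP u : ubound u (unorm u).
Proof.
have ne : [set r | ubound u r] !=set0.
  by exists (rnorm u.1 + rnorm u.2); exact: ubound_ex.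
split; try by apply: lb_le_inf => // r [].
move=> y; have [y0|y0] := eqVneq (rnorm y) 0.
  by rewrite (rnorm_eq0 y0) /act cmulx0 scaler0 addr0 rnorm0 mulr0.
have {}y0 : 0 < rnorm y by rewrite lt0r y0 rnorm_ge0.
rewrite -ler_pdivrMr //; apply: lb_le_inf => // r [_ _ H].
by rewrite ler_pdivrMr.
Qed.

Lemma unorm_ge0 u : 0 <= unorm u.
Proof. by case: (unormP u). Qed.
Lemma unorm_snd u : rnorm u.2 <= unorm u.
Proof. by case: (unormP u). Qed.
Lemma unorm_act u y : rnorm (act u y) <= unorm u * rnorm y.
Proof. by case: (unormP u). Qed.

Lemma unormD u v : unorm (u + v) <= unorm u + unorm v.
Proof.
have [u0 u2 uy] := unormP u; have [v0 v2 vy] := unormP v.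
apply: unorm_le; split; first exact: addr_ge0.
  by apply: le_trans (rnormD _ _) _; apply: lerD.
move=> y; rewrite actD; apply: le_trans (rnormD _ _) _.
by rewrite mulrDl; apply: lerD.
Qed.

Lemma unormZ_le l u : unorm (l *: u.1, l * u.2) <= rnorm l * unorm u.
Proof.
have [u0 u2 uy] := unormP u; have l0 := rnorm_ge0 l.
apply: unorm_le; split; first exact: mulr_ge0.
  by rewrite rnormM ler_wpM2l.
move=> y; rewrite /act /= cscalerAl -scalerA -scalerDr rnormZ -mulrA ler_wpM2l //.
exact: uy.
Qed.

Lemma unormM u v : unorm (unitz_mul u v) <= unorm u * unorm v.
Proof.
have [u0 u2 uy] := unormP u; have [v0 v2 vy] := unormP v.
apply: unorm_le; split; first exact: mulr_ge0.
  by rewrite rnormM ler_pM ?rnorm_ge0.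
move=> y; rewrite act_mul; apply: le_trans (uy _) _.
by rewrite -mulrA ler_wpM2l.
Qed.

Lemma unorm1 : unorm (unitz_one A) = 1.
Proof.
have r1 : rnorm (1 : R[i]) = 1 by rewrite /rnorm normr1.
apply/eqP; rewrite eq_le; apply/andP; split.
  apply: unorm_le; split; rewrite ?r1 // => y.
  by rewrite /act cmul0x scale1r add0r mul1r.
by have := unorm_snd (unitz_one A); rewrite /= r1.
Qed.

(** For [y] in [A], [act u y] is again in [A], where the C*-identity rewrites the square of its norm
    as that of [y] starred times [act (unitz_star u * u) y]; the scalar component is handled
    separately. *)
Lemma unorm_sq u : unorm u ^+ 2 <= unorm (unitz_mul (unitz_star u) u).
Proof.
set s := unorm (unitz_mul _ _); have s0 : 0 <= s by apply: unorm_ge0.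
suff h : unorm u <= Num.sqrt s.
  by rewrite -(sqr_sqrtr s0) ler_pXn2r ?nnegrE ?unorm_ge0 ?sqrtr_ge0.
apply: unorm_le; split; first exact: sqrtr_ge0.
  rewrite -[leLHS](ger0_norm (rnorm_ge0 _)) -sqrtr_sqr ler_wsqrtr //.
  by have := unorm_snd (unitz_mul (unitz_star u) u); rewrite rnormM rnorm_conj -expr2.
move=> y; rewrite -[leLHS](ger0_norm (rnorm_ge0 _)) -sqrtr_sqr.
rewrite -[rnorm y in leRHS](ger0_norm (rnorm_ge0 _)) -[X in _ * X]sqrtr_sqr -sqrtrM //.
rewrite ler_wsqrtr // -rnorm_star_mul star_act -act_mul.
apply: le_trans (rnorm_cmul _ _) _; rewrite rnorm_cstar mulrC expr2 mulrA.
by rewrite ler_wpM2r ?rnorm_ge0 // unorm_act.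
Qed.

Lemma unorm_embed x : unorm (x, 0) = rnorm x.
Proof.
apply/eqP; rewrite eq_le; apply/andP; split.
  by have := unorm_le (ubound_ex (x, 0)); rewrite /= rnorm0 addr0.
(* Testing on the adjoint of [x] makes the C*-identity give [rnorm x ^ 2]. *)
have := unorm_act (x, 0) (cstar x); rewrite /act /= scale0r addr0.
rewrite -{1}(cstarK x) rnorm_star_mul rnorm_cstar.
have [->|x0] := eqVneq (rnorm x) 0; first by rewrite unorm_ge0.
by rewrite expr2 ler_pM2r // lt0r x0 rnorm_ge0.
Qed.

Lemma unorm_eq0 u : unorm u = 0 -> u = 0.
Proof.
move=> u0; have := unorm_snd u; have := rnorm_ge0 u.2; rewrite u0 => h1 h2.
have {h1 h2} h : u.2 = 0 by apply: rnorm_eq0; apply/eqP; rewrite eq_le h1 h2.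
move: u0 h; case: u => x l /= u0 l0; move: u0; rewrite l0 unorm_embed.
by move/rnorm_eq0 ->.
Qed.

(** [(u.1, 0)] is [u - u.2 1], and [u.2] is bounded by [unorm u]: hence the factor 2. *)
Lemma unorm_fst u : rnorm u.1 <= 2 * unorm u.
Proof.
have -> : rnorm u.1 = unorm (u + ((- u.2) *: 0, (- u.2) * 1)).
  by rewrite -unorm_embed; congr unorm; apply/pair_equal_spec; split => /=;
     rewrite ?scaler0 ?addr0 // mulr1 subrr.
apply: le_trans (unormD _ _) _.
have := unormZ_le (- u.2) (unitz_one A); rewrite unorm1 mulr1.
have -> : rnorm (- u.2) = rnorm u.2 by rewrite /rnorm normrN.
have := unorm_snd u; lra.
Qed.

(** [unorm] is equivalent to the product norm: [unorm_fst] and [unorm_snd] make the components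
    Cauchy, and [ubound_ex] brings their limits back. The scalar component converges through its
    real and imaginary parts. *)
Lemma unorm_complete (z : nat -> A * R[i]) (C rho : R) : 0 <= rho -> rho < 1 ->
  (forall n, unorm (z n.+1 - z n) <= C * rho ^+ n) ->
  exists w, forall e, 0 < e ->
    exists n0, forall n, (n0 <= n)%N -> unorm (z n - w) <= e.
Proof.
move=> r0 r1 hz.
have u0 : unorm 0 = 0 by rewrite -[0 in LHS]/(0, 0) unorm_embed rnorm0.
have C0 : 0 <= C.
  by have := hz 0%N; rewrite expr0 mulr1; apply: le_trans; exact: unorm_ge0.
have hc := geometric_cauchy u0 unormD C0 r0 r1 hz.
have {}hc e : 0 < e -> exists n0, forall n, (n0 <= n)%N -> unorm (z n - z n0) <= e.
  move=> /hc[n0 h]; exists n0 => n nn0.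
  by have := h n0 (n - n0)%N (leqnn _); rewrite subnKC.
have [x hx] : exists x : A, forall e : R[i], 0 < e -> exists n0, forall n,
    (n0 <= n)%N -> `|(z n).1 - x| <= e.
  apply: (@cauchy_seq_limit R[i] A (fun n => (z n).1)) => e.
  rewrite ltcE => /andP[/eqP Ie Re0].
  have [|n0 h] := hc (complex.Re e / 2); first by rewrite divr_gt0.
  exists n0 => n /h h'; rewrite rnormE lecE /= Ie eqxx /=.
  have := unorm_fst (z n - z n0); rewrite /= => h3.
  by apply: le_trans h3 _; move: h'; lra.
have limR (f : R[i] -> R) : (forall k l, f (k - l) = f k - f l) ->
    (forall l, `|f l| <= rnorm l) ->
    exists a, forall e : R, 0 < e -> exists n0, forall n,
    (n0 <= n)%N -> `|f (z n).2 - a| <= e.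
  move=> fB fn; apply: (@cauchy_seq_limit R R (fun n => f (z n).2)) => e e0.
  have [n0 h] := hc e e0; exists n0 => n /h h'.
  rewrite -fB; apply: le_trans (fn _) _; apply: le_trans h'.
  exact: (unorm_snd (z n - z n0)).
have [a ha] := limR _ (raddfB (@complex.Re R)) (@norm_Re_le R).
have [b hb] := limR _ (raddfB (@complex.Im R)) (@norm_Im_le R).
exists (x, a +i* b) => e e0; have e30 : 0 < e / 3 by rewrite divr_gt0.
have [|n1 h1] := hx (e / 3)%:C; first by rewrite ltcR.
have [n2 h2] := ha _ e30; have [n3 h3] := hb _ e30.
exists (maxn n1 (maxn n2 n3)) => n; rewrite !geq_max => /and3P[k1 k2 k3].
apply: le_trans (unorm_le (ubound_ex _)) _ => /=.
have := h1 n k1; rewrite rnormE lecR => {}h1.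
apply: le_trans (lerD h1 (rnorm_le _)) _; rewrite !raddfB /=.
have := h2 n k2; have := h3 n k3; lra.
Qed.
End CStar.

(** * The unitization as a unital C*-algebra *)

Definition unitization (R : realType) (A : cstarAlgType R) : Type :=
  (A * R[i]^o)%type.

HB.instance Definition _ (R : realType) (A : cstarAlgType R) :=
  GRing.Lmodule.copy (unitization A) (A * R[i]^o)%type.

HB.instance Definition _ (R : realType) (A : cstarAlgType R) :=
  GRing.Zmodule_isNzRing.Build (unitization A) (@unitz_mulA R A)
    (@unitz_mul1l R A) (@unitz_mul1r R A) (@unitz_mulDl R A)
    (@unitz_mulDr R A) (@unitz_1neq0 R A).

Lemma unitz_scalerAl (R : realType) (A : cstarAlgType R) (l : R[i])
    (u v : unitization A) : l *: (u * v) = l *: u * v.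
Proof.
case: u v => [x k] [y m]; congr pair => /=; last exact: mulrA.
by rewrite !scalerDr cscalerAl !scalerA (mulrC m l).
Qed.

HB.instance Definition _ (R : realType) (A : cstarAlgType R) :=
  GRing.Lmodule_isLalgebra.Build R[i] (unitization A) (@unitz_scalerAl R A).

Lemma unitz_scalerAr (R : realType) (A : cstarAlgType R) (l : R[i])
    (u v : unitization A) : l *: (u * v) = u * (l *: v).
Proof.
case: u v => [x k] [y m]; congr pair => /=; last exact: mulrCA.
by rewrite !scalerDr cscalerAr !scalerA (mulrC k l).
Qed.

HB.instance Definition _ (R : realType) (A : cstarAlgType R) :=
  GRing.Lalgebra_isAlgebra.Build R[i] (unitization A) (@unitz_scalerAr R A).

Section Unitization.
Context {R : realType} {A : cstarAlgType R}.
Implicit Types (u v : unitization A) (l : R[i]).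

Lemma unitz_starK u : unitz_star (unitz_star u) = u.
Proof. by case: u => x k; rewrite /unitz_star /= cstarK conjCK. Qed.

Lemma unitz_starD u v :
  unitz_star (u + v) = unitz_star u + unitz_star v :> unitization A.
Proof. by rewrite /unitz_star /= cstarD rmorphD. Qed.

Lemma unitz_starZ l u :
  unitz_star (l *: u) = Num.conj l *: (unitz_star u : unitization A).
Proof. by rewrite /unitz_star /= cstarZ rmorphM. Qed.

Lemma unitz_starM u v :
  unitz_star (u * v) = (unitz_star v : unitization A) * unitz_star u.
Proof.
case: u v => [x k] [y m]; congr pair => /=; last by rewrite rmorphM mulrC.
by rewrite !cstarD !cstarZ cstarM addrAC.
Qed.

HB.instance Definition _ := Algebra_isUnitalCStar.Build R (unitization A)
  unitz_starK unitz_starD unitz_starZ unitz_starM (@unormD R A)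
  (@unormZ_le R A) (@unorm1 R A) (@unorm_eq0 R A) (@unormM R A)
  (@unorm_sq R A) (@unorm_complete R A).
End Unitization.

(** * Embedding of the algebra in its unitization, and the two notions of positivity *)

Section Embedding.
Context {R : realType} {A : cstarAlgType R}.
Implicit Types (x y a b c d : A) (t : R).

Definition emb x : unitization A := (x, 0).

Lemma emb_inj : injective emb.
Proof. by move=> x y []. Qed.

Lemma embD x y : emb (x + y) = emb x + emb y.
Proof. by congr pair; rewrite /= addr0. Qed.
Lemma embB x y : emb (x - y) = emb x - emb y.
Proof. by congr pair; rewrite /= subrr. Qed.
Lemma embM x y : emb (cmul x y) = emb x * emb y.
Proof. by congr pair => /=; [rewrite !scale0r !addr0|rewrite mulr0]. Qed.
Lemma embZ t x : emb (t%:C *: x) = scal t * emb x.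
Proof. by rewrite /scal -scalerAl mul1r; congr pair; rewrite /= scaler0. Qed.
Lemma sa_emb x : self_adjoint x <-> sa (emb x).
Proof.
split=> [sx|[]//]; rewrite /sa -[LHS]/(unitz_star (emb x)) /unitz_star /= sx.
by rewrite conjC0.
Qed.
Lemma cnorm_emb x : cnorm (emb x) = rnorm x.
Proof. exact: unorm_embed. Qed.

Lemma emb_sub_scalar x l : emb x - l%:A = (x, - l) :> unitization A.
Proof.
congr pair => /=; first by rewrite scaler0 subr0.
by rewrite sub0r; congr (- _); apply: mulr1.
Qed.

(** [(x, - l)] is [emb x - l]: the values [l = - t < 0] give the hypothesis of [psd_of_inv], and
    [inv_sub_of_psd] gives the converse. *)
Lemma positive_emb x : positive A x <-> psd (emb x).
Proof.
split=> [[sx hx]|px].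
  apply: psd_of_inv; first exact/sa_emb.
  move=> t t0; have -> : emb x + scal t = (x, - (- t%:C)) :> unitization A.
    by rewrite -emb_sub_scalar scaleNr opprK.
  apply: contrapT => nt.
  by have := hx _ nt; rewrite /= lecE /= oppr_ge0 leNgt t0 andbF.
split; first by apply/sa_emb; case: px.
move=> l; apply: contra_notT => l0.
have [v [v1 v2]] := inv_sub_of_psd px l0.
by exists v; rewrite -emb_sub_scalar.
Qed.
End Embedding.


(** * Transfer of both implications from the unitization *)

Theorem theorem2p1 (R : realType) (A : cstarAlgType R) (a b : A)
    (ha : positive A a) (ha0 : a <> 0) (hb : positive A b) (hb0 : b <> 0) :
  cmul a b = 0 <->
  (forall c d : A,
     positive A c -> c <> 0 -> cle c a ->
     positive A d -> d <> 0 -> cle d b ->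
     `| `|c|^-1 *: c + `|d|^-1 *: d | = 1 :> R[i]%C).
Proof.
have emb_eq0 (x : A) : x <> 0 -> emb x <> 0 by move=> x0 /emb_inj.
have normE (c d : A) : `| `|c|^-1 *: c + `|d|^-1 *: d | =
    (cnorm (scal (cnorm (emb c))^-1 * emb c + scal (cnorm (emb d))^-1 * emb d))%:C%C.
  by rewrite !rnormE -!fmorphV /= -(cnorm_emb (_ + _)) embD !embZ !cnorm_emb.
have [/positive_emb pa /positive_emb pb] := (ha, hb).
split=> [ab c d /positive_emb pc c0 [_ _ /positive_emb pac]
    /positive_emb pd d0 [_ _ /positive_emb pbd]|H].
  rewrite embB in pac; rewrite embB in pbd.
  have [[sa_a _] [sb _] [sc_ _] [sd _]] := And4 pa pb pc pd.
  have eab : emb a * emb b = 0 by rewrite -embM ab.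
  (* Orthogonality descends twice, from [a] to [c] against [b], then from [b] to [d] against [c];
     adjoints exchange the factors. *)
  have ecb := orthogonal_of_le pb pc pac eab.
  have edc := orthogonal_of_le pc pd pbd (sa_mul0 sc_ sb ecb).
  have ecd := sa_mul0 sd sc_ edc.
  have Npos (x : A) : x <> 0 -> 0 < cnorm (emb x).
    move=> x0; rewrite lt0r cnorm_ge0 andbT; apply/eqP => /cnorm_eq0.
    exact: emb_eq0.
  have Nunit (x : A) : x <> 0 -> cnorm (scal (cnorm (emb x))^-1 * emb x) = 1.
    move=> /Npos x0; rewrite cnorm_scalM gtr0_norm ?invr_gt0 // mulVf // gt_eqF //.
  rewrite normE cnorm_add_orthogonal //; try exact: Nunit.
  - exact: saM (sa_scal _) sc_ (scal_comm _ _).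
  - exact: saM (sa_scal _) sd (scal_comm _ _).
  - by rewrite -mulrA (mulrA (emb c)) (comm_scal (emb c)) -mulrA ecd !mulr0.
apply: emb_inj; rewrite embM.
apply: mul0_of_norm_add => //; try exact: emb_eq0.
(* [A] is an ideal: [z * emb a * z] has scalar part 0, so the test element comes from [A]. *)
move=> [c l] z cE pc c0 pac.
have {cE} l0 : l = 0.
  by have := congr1 snd cE; rewrite /= mulr0 mul0r.
rewrite l0 -/(emb c) in pc c0 pac *.
apply: (@complexI R); rewrite -normE; apply: H => //.
- exact/positive_emb.
- by move=> c1; apply: c0; rewrite c1.
- split; [by apply/sa_emb; case: pc|by apply/sa_emb; case: pa|].
  by apply/positive_emb; rewrite embB.
(* [b] itself serves as [d]; what remains is [b <= b], that is, [psd 0]. *)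
split; [by apply/sa_emb; case: pb|by apply/sa_emb; case: pb|].
apply/positive_emb; rewrite embB subrr.
by have := @psd_scal R (unitization A) 0 (lexx _); rewrite scal0.
Qed.
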